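(* Let $D$ be a finite set with $m+1$ elements ($m\ge1$), $n\ge1$, $\epsilon\ge0$, $0\le\delta\le1$, $0\le p\le\frac1{m+1}$. Let $\{X_d\mid d\in D\}$ be the parent mechanism with $\mathbb{P}(X_d=d)=1-pm$ and $\mathbb{P}(X_d=d')=p$ for all $d'\ne d$, and suppose it is $(\epsilon,\delta)$-differentially private, i.e. $\mathbb{P}(X_d\in A)\le e^{\epsilon}\mathbb{P}(X_{d'}\in A)+\delta$ for all $d,d'\in D$ and $A\subseteq D$. Then the error $\mathcal{E}=\max_{\mathbf{d}\in D^n}\mathbb{E}[h(X_{\mathbf{d}},\mathbf{d})]$ of its product sanitisation mechanism $\{X_{\mathbf{d}}\}$ satisfies $$\frac{1-\delta}{1+\frac{e^{\epsilon}}{m}}\le\frac{\mathcal{E}}{n}\le\frac{m}{m+1}.$$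
   Context: The product sanitisation mechanism with parent $\{X_d\}$ is $X_{\mathbf{d}}=(X^1_{\mathbf{d}},\dots,X^n_{\mathbf{d}})$, $\mathbf{d}\in D^n$, with independent coordinates and $X^i_{\mathbf{d}}$ distributed as $X_{d_i}$. $h$ is the Hamming distance on $D^n$ (number of differing coordinates). *)

(* Defs.v *)
From HB Require Import structures.
From mathcomp Require Export all_boot all_order all_algebra.
From mathcomp Require Export all_classical all_reals all_analysis.

Set Implicit Arguments.
Unset Strict Implicit.
Unset Printing Implicit Defensive.

Import Order.TTheory GRing.Theory Num.Theory.
Local Open Scope classical_set_scope.
Local Open Scope ring_scope.
Local Open Scope ereal_scope.

(* A random element of a finite set E, which carries the discrete sigma-algebra:
   every subset of E is an event. *)
Definition finite_rv (disp : measure_display) (T : measurableType disp)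
    (E : finType) (X : T -> E) : Prop :=
  forall A : set E, measurable (X @^-1` A).

(* The responses lie in the space of databases itself. *)
Definition sanitisation_mechanism (disp : measure_display)
    (T : measurableType disp) (E : finType) (X : E -> T -> E) : Prop :=
  forall d : E, finite_rv (X d).

Definition diff_private (R : realType) (disp : measure_display)
    (T : measurableType disp) (P : probability T R) (E : finType)
    (X : E -> T -> E) (eps delta : R) : Prop :=
  forall (d d' : E) (A : set E),
    P (X d @^-1` A) <= (expR eps)%:E * P (X d' @^-1` A) + delta%:E.

(* Mutual independence: the product rule over every subfamily. *)
Definition mutually_independent (R : realType) (disp : measure_display)
    (T : measurableType disp) (P : probability T R) (E I : finType)
    (Z : I -> T -> E) : Prop :=
  forall (J : {set I}) (A : I -> set E),
    P (\bigcap_(i in [set` J]) (Z i @^-1` A i)) =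
    \prod_(i in J) P (Z i @^-1` A i).

Definition hamming (E : eqType) (n : nat) (x y : n.-tuple E) : nat :=
  #|[pred i : 'I_n | tnth x i != tnth y i]|.

(* Y, defined on (T', Q), is a product sanitisation mechanism with parent X,
   defined on (T, P); only the laws of the X d matter, so the two probability
   spaces may differ. *)
Definition product_mechanism (R : realType)
    (disp : measure_display) (T : measurableType disp) (P : probability T R)
    (disp' : measure_display) (T' : measurableType disp')
    (Q : probability T' R) (E : finType) (n : nat)
    (X : E -> T -> E) (Y : n.-tuple E -> T' -> n.-tuple E) : Prop :=
  sanitisation_mechanism Y /\
  forall dd : n.-tuple E,
    mutually_independent Q (fun (i : 'I_n) w => tnth (Y dd w) i) /\
    forall (i : 'I_n) (A : set E),
      Q ((fun w => tnth (Y dd w) i) @^-1` A) = P (X (tnth dd i) @^-1` A).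

(* -oo is the neutral element of maxe, so this is the maximum as soon as
   n.-tuple E is nonempty. *)
Definition mechanism_error (R : realType) (disp : measure_display)
    (T : measurableType disp) (Q : probability T R) (E : finType) (n : nat)
    (Y : n.-tuple E -> T -> n.-tuple E) : \bar R :=
  \big[maxe/-oo]_(dd : n.-tuple E)
    'E_Q[fun w => (hamming (Y dd w) dd)%:R%R].

(* Main.v *)
(** By linearity of expectation, each [E (h (X_dd, dd))] is the sum of the [n]
    coordinate error probabilities, all equal to [p m], so the error divided by
    [n] is exactly [p m].  The upper bound is [p <= 1 / (m + 1)]; the lower bound
    comes from privacy applied to the event [{d}] and any [d' <> d], namely
    [1 - p m <= e^eps p + delta]. *)
Require Import Defs.
From mathcomp Require Import measurable_realfun ring lra.

Set Implicit Arguments.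
Unset Strict Implicit.
Unset Printing Implicit Defensive.

Import Order.TTheory GRing.Theory Num.Theory.
Local Open Scope classical_set_scope.
Local Open Scope ring_scope.
Local Open Scope ereal_scope.

(** The distance is a sum of indicators, one for each event that a coordinate is wrong, and the
    integral is additive on nonnegative functions. *)
Lemma expectation_hamming (R : realType) (disp : measure_display)
    (T : measurableType disp) (Q : probability T R) (E : finType) (n : nat)
    (Z : T -> n.-tuple E) (t : n.-tuple E) :
  finite_rv Z ->
  'E_Q[fun w => (hamming (Z w) t)%:R%R] =
  \sum_(i < n) Q ((fun w => tnth (Z w) i) @^-1` (~` [set tnth t i])).
Proof.
move=> mZ.
pose B i := (fun w => tnth (Z w) i) @^-1` (~` [set tnth t i]).
have mB i : measurable (B i).
  (* [B i] is also the preimage under [Z] of a set of tuples, and every such set is an event. *)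
  exact: (mZ [set y | tnth y i <> tnth t i]).
have hammingE w : (hamming (Z w) t)%:R%:E = \sum_(i < n) (\1_(B i) w : R)%:E.
  rewrite sumEFin /hamming -sum1_card natr_sum big_mkcond /=; congr _%:E.
  apply: eq_bigr => i _; rewrite indicE inE /=.
  case: ifPn => [/eqP neq|/negPn/eqP eq]; first by rewrite mem_set.
  by rewrite memNset // => /(_ eq).
rewrite unlock; under eq_integral do rewrite hammingE.
rewrite ge0_integral_sum //.
- by apply: eq_bigr => i _; rewrite integral_indic // setIT.
- by move=> i; apply/measurable_EFinP; exact: measurable_indic.
Qed.

(** The witness [i0] excludes the empty maximum, which would be [-oo]. *)
Lemma bigmax_cst (R : realType) (I : finType) (i0 : I) (F : I -> \bar R) c :
  (forall i, F i = c) -> \big[maxe/-oo]_i F i = c.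
Proof.
move=> Fc; apply/eqP; rewrite eq_le; apply/andP; split.
  by apply: bigmax_le => [|i _]; rewrite ?leNye ?Fc.
by rewrite -(Fc i0); exact: le_bigmax.
Qed.

(** Each coordinate is wrong with probability [q] whatever the database, so the maximum runs over a
    constant family. *)
Lemma product_mechanism_error (R : realType)
    (disp : measure_display) (T : measurableType disp) (P : probability T R)
    (disp' : measure_display) (T' : measurableType disp')
    (Q : probability T' R) (E : finType) (n : nat)
    (X : E -> T -> E) (Y : n.-tuple E -> T' -> n.-tuple E) (q : R) :
  (0 < #|E|)%N -> sanitisation_mechanism X -> product_mechanism P Q X Y ->
  (forall d, P (X d @^-1` [set d]) = (1 - q)%:E) ->
  mechanism_error Q Y = (n%:R * q)%:E.
Proof.
move=> /card_gt0P[d0 _] mX [mY lawY] PX.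
apply: (bigmax_cst [tuple d0 | i < n]) => t.
rewrite expectation_hamming //.
under eq_bigr => i _.
  rewrite (lawY t).2 -preimage_setC probability_setC; last exact: mX.
  rewrite PX -EFinB opprB addrCA subrr addr0; over.
by rewrite sumEFin sumr_const card_ord mulr_natl.
Qed.

Theorem theorem9 (R : realType) (D : finType) (m n : nat)
  (hm : (1 <= m)%N) (hD : #|D| = m.+1) (hn : (1 <= n)%N)
  (eps delta p : R)
  (heps : (0 <= eps)%R) (hdelta : (0 <= delta <= 1)%R)
  (hp : (0 <= p <= 1 / m.+1%:R)%R)
  (disp : measure_display) (T : measurableType disp) (P : probability T R)
  (X : D -> T -> D)
  (hX : sanitisation_mechanism X)
  (hXeq : forall d : D, P (X d @^-1` [set d]) = (1 - p * m%:R)%:E)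
  (hXneq : forall d d' : D, d' <> d -> P (X d @^-1` [set d']) = p%:E)
  (hDP : diff_private P X eps delta)
  (disp' : measure_display) (T' : measurableType disp')
  (Q : probability T' R) (Y : n.-tuple D -> T' -> n.-tuple D)
  (hY : product_mechanism P Q X Y) :
  ((1 - delta) / (1 + expR eps / m%:R))%:E
    <= mechanism_error Q Y / n%:R%:E /\
  mechanism_error Q Y / n%:R%:E <= (m%:R / m.+1%:R)%:E.
Proof.
have n0 : n%:R != 0%R :> R by rewrite pnatr_eq0 -lt0n.
have m0 : (0 < m%:R :> R)%R by rewrite ltr0n.
have -> : mechanism_error Q Y / n%:R%:E = (p * m%:R)%:E.
  rewrite (product_mechanism_error _ hX hY hXeq) ?hD //.
  (* Inversion in [\bar R] treats [0] separately; [n0] selects the real inverse. *)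
  by rewrite inver (negbTE n0) -EFinM mulrAC divff // mul1r.
rewrite !lee_fin; split; last first.
  by rewrite mulrC ler_wpM2l ?ler0n // -div1r; case/andP: hp.
have /card_gt1P[d [d' [_ _ /eqP dd']]] : (1 < #|D|)%N by rewrite hD ltnS.
have := hDP d d' [set d]; rewrite hXeq hXneq // -EFinM -EFinD lee_fin => priv.
have e0 := expR_gt0 eps.
rewrite ler_pdivrMr; last by rewrite addr_gt0 // divr_gt0.
(* Once the denominator is cleared and the product expanded, the goal is [priv] rearranged. *)
have -> : (p * m%:R * (1 + expR eps / m%:R) = p * m%:R + expR eps * p)%R.
  by field; rewrite gt_eqF.
lra.
Qed.
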